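(* Let $u_h$ be the fine-grid semi-discrete solution and let $w_H\in V_H$ be its elliptic projection, i.e. $a_{DG}(w_H,v)=a_{DG}(u_h,v)+R_{u_h}(v)$ for all $v\in V_H$ (notation in the context). Then there is a constant $C>0$, independent of $h$, $H$, $u_h$ and $w_H$, such that $$\|u_h-w_H\|_a\le C\big(\|u_h-v\|_a+h\,C(u,f)\big)\qquad\text{for all } v\in V_H,$$ where $C(u,f)$ is the consistency constant defined in the context.
   Context: Meshes and coefficient. $\Omega\subset\mathbb R^2$ is a bounded domain partitioned by a fine mesh $\mathcal T^h$ of rectangles with maximum side length $h$. $\mathcal T^H$ is a coarse mesh of size $H$ whose blocks $K$ are connected unions of fine rectangles; $\mathcal E^H$ is the set of coarse edges. The coefficient $a(x)$ satisfies $a_0\le a(x)\le a_1$ for all $x\in\Omega$, with constants $a_0,a_1>0$. $(\cdot,\cdot)$ is the $L^2(\Omega)$ inner product. Solutions. $u$ is the exact solution of $\partial_t^2u=\nabla\cdot(a\nabla u)+f$ in $[0,T]\times\Omega$, $u=0$ on $[0,T]\times\partial\Omega$, $u(\cdot,0)=g_0$, $u_t(\cdot,0)=g_1$. $V_h$ is the space of continuous piecewise bilinear functions on $\mathcal T^h$ vanishing on $\partial\Omega$, and $u_h(t,\cdot)\in V_h$ satisfies $(\partial_t^2u_h,v)+\int_\Omega a\nabla u_h\cdot\nabla v=(f,v)$ for all $v\in V_h$. All quantities are considered at a fixed time $t\in[0,T]$. Multiscale space. For a coarse block $K$, $V_h(K)$ is the space of continuous piecewise bilinear functions on the fine rectangles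 of $K$, and $V_h^0(K)$ is the subspace of functions vanishing on $\partial K$. $V_H^1(K)$ is the $n$-dimensional space ($n$ = number of fine nodes on $\partial K$, depending on $K$) of $w\in V_h(K)$ with $\int_Ka\nabla w\cdot\nabla v=0$ for all $v\in V_h^0(K)$; $V_H^1$ is the space of functions whose restriction to each $K$ lies in $V_H^1(K)$. Let $0=\mu_{1,K}<\mu_{2,K}\le\dots\le\mu_{n,K}$ and $\widetilde w_{i,K}\in V_H^1(K)$ be the eigenpairs of $\int_Ka\nabla w\cdot\nabla v=\frac{\mu}{H}\int_{\partial K}wv$ for all $v\in V_H^1(K)$, the $\widetilde w_{i,K}$ orthonormal in $L^2(\partial K)$. Let $\lambda_{1,K}\le\lambda_{2,K}\le\dots$ and $z_{i,K}\in V_h^0(K)$ be the eigenpairs of $\int_Ka\nabla z\cdot\nabla v=\frac{\lambda}{H^2}\int_Kzv$ for all $v\in V_h^0(K)$, the $z_{i,K}$ orthonormal in $L^2(K)$. For chosen integers $p,m$ (possibly depending on $K$), $V_H$ is the space of functions on $\Omega$, in general discontinuous across coarse edges, whose restriction to each $K$ lies in $\mathrm{span}\{\widetilde w_{1,K},\dots,\widetilde w_{p,K},z_{1,K},\dots,z_{m,K}\}$. Interior penalty form. For an interior coarse edge $e$ shared by $K^+$ and $K^-$, with unit normal $n$ pointing from $K^+$ to $K^-$, $\{v\}_e=\frac12(v^++v^-)$ and $[v]_e=v^+-v^-$; for $e\subset\partial\Omega$, with $n$ the outward normal, $\{v\}_e=[v]_e=v$. With penalty parameter $\gamma>0$, $$a_{DG}(u,v)=\sum_{K\in\mathcal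 T^H}\int_Ka\nabla u\cdot\nabla v+\sum_{e\in\mathcal E^H}\Big(-\int_e\{a\nabla u\cdot n\}_e[v]_e-\int_e\{a\nabla v\cdot n\}_e[u]_e+\frac{\gamma}{h}\int_ea[u]_e[v]_e\Big),$$ and $\|u\|_a^2=\sum_K\int_Ka|\nabla u|^2+\frac{\gamma}{h}\sum_{e\in\mathcal E^H}\|a^{1/2}[u]_e\|_{L^2(e)}^2$. Penalty parameter. $\gamma$ is taken sufficiently large that $\frac12\|v\|_a^2\le a_{DG}(v,v)$ and $a_{DG}(u,v)\le2\|u\|_a\|v\|_a$ for all $u,v$ whose restrictions to each coarse block $K$ lie in $V_h(K)$. Consistency error. $R_{u_h}(v)=(f,v)-(\partial_t^2u_h,v)-a_{DG}(u_h,v)$. $C(u,f)$ denotes a constant, depending on $u$ and $f$ but not on $h$, such that $|R_{u_h}(v)|\le C(u,f)\,h\,\|v\|_a$ for all $v\in V_H^1$ (for $u\in H^2(\Omega)$ the paper takes it comparable to $\|f_t\|_{L^1([0,T];L^2(\Omega))}+\|u_{tt}(\cdot,0)\|_{L^2(\Omega)}+a_1|u|_{H^2(\Omega)}$). *)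

(* Defs.v *)
From HB Require Import structures.
From mathcomp Require Import all_boot all_order all_algebra.
From mathcomp Require Import all_classical all_reals all_analysis.
Set Implicit Arguments.
Unset Strict Implicit.
Unset Printing Implicit Defensive.
Import Order.TTheory GRing.Theory Num.Theory.
Import numFieldNormedType.Exports.
Local Open Scope classical_set_scope.
Local Open Scope ring_scope.

Notation area := (@lebesgue_measure _ \x @lebesgue_measure _)%E.

Section Plane.
Context {R : realType}.
Implicit Types (A Omega : set (R * R)) (phi : R * R -> R) (x : R * R).

Definition frontier A : set (R * R) := closure A `\` A°.

Definition domain Omega : Prop :=
  [/\ Omega !=set0, open Omega, connected Omega & bounded_set Omega].

Definition pd1 phi x : R := derive1 (fun s => phi (s, x.2)) x.1.
Definition pd2 phi x : R := derive1 (fun s => phi (x.1, s)) x.2.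

Definition L2 Omega phi : Prop :=
  measurable_fun Omega phi /\
  area.-integrable Omega (fun x => (phi x ^+ 2)%:E).

(* The bounds are imposed up to the boundary because the penalty and flux
   terms integrate a over edges contained in the frontier of Omega. *)
Definition coefficient Omega (a : R * R -> R) (a0 a1 : R) : Prop :=
  [/\ 0 < a0, 0 < a1, measurable_fun (closure Omega) a &
      forall x, closure Omega x -> a0 <= a x <= a1].

(* Derivative on the closed interval [0, T], one-sided at its endpoints. *)
Definition time_derivative (T : R) (g dg : R -> R) : Prop :=
  forall t, 0 <= t <= T ->
    (fun s => (g s - g t) / (s - t)) @ within [set s | 0 <= s <= T] t^'
      --> dg t.

(* C^1 functions with compact support in Omega. *)
Definition test_function Omega phi : Prop :=
  [/\ forall x, derivable (fun s => phi (s, x.2)) x.1 1,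
      forall x, derivable (fun s => phi (x.1, s)) x.2 1,
      continuous (pd1 phi), continuous (pd2 phi) &
      exists A, [/\ compact A, A `<=` Omega & forall x, ~ A x -> phi x = 0]].

(* u is in H^1_0(Omega), the closure of the test functions in the H^1 norm,
   and g is its weak gradient. *)
Definition H10 Omega (u : R * R -> R) (g : R * R -> R * R) : Prop :=
  [/\ L2 Omega u, L2 Omega (fun x => (g x).1), L2 Omega (fun x => (g x).2) &
      forall eps : R, 0 < eps -> exists2 phi, test_function Omega phi &
        \int[area]_(x in Omega) ((u x - phi x) ^+ 2
           + ((g x).1 - pd1 phi x) ^+ 2 + ((g x).2 - pd2 phi x) ^+ 2) < eps].

(* Finite energy weak solution on [0, T] of
   u_tt = div (a grad u) + f,  u = 0 on the frontier of Omega,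
   u(0) = g0,  u_t(0) = g1. *)
Definition wave_solution Omega (a : R * R -> R) (T : R)
    (f : R -> R * R -> R) (g0 g1 : R * R -> R) (u : R -> R * R -> R) : Prop :=
  [/\ L2 Omega g0, L2 Omega g1, {ae area, forall x, Omega x -> u 0 x = g0 x} &
  exists G : R -> R * R -> R * R,
  [/\ forall t, 0 <= t <= T -> H10 Omega (u t) (G t),
      forall t, 0 <= t <= T ->
        (fun s => \int[area]_(x in Omega) ((u s x - u t x) ^+ 2
           + ((G s x).1 - (G t x).1) ^+ 2 + ((G s x).2 - (G t x).2) ^+ 2))
          @ within [set s | 0 <= s <= T] (nbhs t) --> (0 : R) &
      forall phi, test_function Omega phi -> exists d1 d2 : R -> R,
      [/\ time_derivative T
            (fun t => \int[area]_(x in Omega) (u t x * phi x)) d1,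
          time_derivative T d1 d2,
          d1 0 = \int[area]_(x in Omega) (g1 x * phi x) &
          forall t, 0 <= t <= T ->
            d2 t + \int[area]_(x in Omega)
                     (a x * ((G t x).1 * pd1 phi x + (G t x).2 * pd2 phi x))
            = \int[area]_(x in Omega) (f t x * phi x)]]].

(* The bilinear function q0 + q1 x + q2 y + q3 x y, defined on the whole
   plane, so that traces on the sides of a cell are plain values. *)
Definition bilin (q : 'rV[R]_4) x : R :=
  q 0 0 + q 0 1 * x.1 + q 0 2 * x.2 + q 0 3 * (x.1 * x.2).

End Plane.

(* The sides of a rectangle: (false, b) is the side orthogonal to the first
   axis, (true, b) the one orthogonal to the second axis, and b tells whether
   it is the one with the larger coordinate. *)
Definition side := (bool * bool)%type.
Definition opposite (s : side) : side := (s.1, ~~ s.2).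
Definition normal {R : realType} (s : side) : R * R :=
  let e : R := if s.2 then 1 else -1 in if s.1 then (0, e) else (e, 0).

(* The cells are the closed axis-parallel rectangles [lo c, hi c], and
   (b1, b2) indexes their corners. *)
Section Cell.
Context {R : realType} {I : Type} (lo hi : I -> R * R).

Definition box (c : I) : set (R * R) :=
  [set x | (lo c).1 <= x.1 <= (hi c).1 /\ (lo c).2 <= x.2 <= (hi c).2].
Definition box_corner (c : I) (i : bool * bool) : R * R :=
  (if i.1 then (hi c).1 else (lo c).1, if i.2 then (hi c).2 else (lo c).2).
Definition box_side (c : I) (s : side) : set (R * R) :=
  [set x | box c x /\
     (if s.1 then x.2 = (box_corner c (s.2, s.2)).2
      else x.1 = (box_corner c (s.2, s.2)).1)].
End Cell.

(* Conforming: distinct cells meet in nothing, a common corner or a full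
   common side. *)
Record fine_mesh (R : realType) := FineMesh {
  cell : finType;
  lo : cell -> R * R;
  hi : cell -> R * R;
  _ : forall c, (lo c).1 < (hi c).1 /\ (lo c).2 < (hi c).2;
  _ : forall c d, c != d ->
    [\/ box lo hi c `&` box lo hi d = set0,
        exists i j, box lo hi c `&` box lo hi d = [set box_corner lo hi c i]
                    /\ box_corner lo hi c i = box_corner lo hi d j |
        exists s, box lo hi c `&` box lo hi d = box_side lo hi c s
                  /\ box_side lo hi c s = box_side lo hi d (opposite s)]
}.

Section FineMesh.
Context {R : realType} (M : fine_mesh R).

Definition rect (c : cell M) : set (R * R) := box (@lo R M) (@hi R M) c.
Definition corner (c : cell M) (i : bool * bool) : R * R :=
  box_corner (@lo R M) (@hi R M) c i.
Definition sideset (c : cell M) (s : side) : set (R * R) :=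
  box_side (@lo R M) (@hi R M) c s.

(* The second condition excludes domains with slits along cell sides. *)
Definition fine_partition (Omega : set (R * R)) : Prop :=
  closure Omega = \bigcup_(c in [set: cell M]) rect c /\
  Omega = (\bigcup_(c in [set: cell M]) rect c)°.

(* h, the maximum side length *)
Definition fine_size : R :=
  \big[Num.max/0]_(c : cell M)
    Num.max ((hi c).1 - (lo c).1) ((hi c).2 - (lo c).2).

Definition cell_int (c : cell M) (g : R * R -> R) : R :=
  \int[area]_(x in (rect c)°) g x.

Definition side_int (c : cell M) (s : side) (g : R * R -> R) : R :=
  if s.1 then
    \int[@lebesgue_measure R]_(r in `[(lo c).1, (hi c).1])
      g (r, (corner c (s.2, s.2)).2)
  else
    \int[@lebesgue_measure R]_(r in `[(lo c).2, (hi c).2])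
      g ((corner c (s.2, s.2)).1, r).

(* Broken piecewise bilinear functions. *)
Definition pwbilin := {ffun cell M -> 'rV[R]_4}.

Definition ev (v : pwbilin) (c : cell M) (x : R * R) : R := bilin (v c) x.

(* Continuity on a union of closed cells amounts to the agreement of the
   pieces on the intersections of cells. *)
Definition continuous_on (P : pred (cell M)) (v : pwbilin) : Prop :=
  forall c d x, P c -> P d -> rect c x -> rect d x -> ev v c x = ev v d x.

Definition Vh (Omega : set (R * R)) (v : pwbilin) : Prop :=
  continuous_on predT v /\
  forall c x, rect c x -> frontier Omega x -> ev v c x = 0.

Definition L2dot (g : R * R -> R) (v : pwbilin) : R :=
  \sum_(c : cell M) cell_int c (fun x => g x * ev v c x).

Definition L2dot_pw (w v : pwbilin) : R :=
  \sum_(c : cell M) cell_int c (fun x => ev w c x * ev v c x).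

Definition cell_energy (a : R * R -> R) (c : cell M) (u v : pwbilin) : R :=
  cell_int c (fun x => a x * (pd1 (ev u c) x * pd1 (ev v c) x
                              + pd2 (ev u c) x * pd2 (ev v c) x)).

(* ut is the velocity and utt the acceleration of uh. *)
Definition semidiscrete_solution (Omega : set (R * R)) (a : R * R -> R) (T : R)
    (f : R -> R * R -> R) (uh ut utt : R -> pwbilin) : Prop :=
  [/\ forall c x, time_derivative T (fun t => ev (uh t) c x)
                                    (fun t => ev (ut t) c x),
      forall c x, time_derivative T (fun t => ev (ut t) c x)
                                    (fun t => ev (utt t) c x),
      forall t, 0 <= t <= T -> Vh Omega (uh t) &
      forall t, 0 <= t <= T -> forall v, Vh Omega v ->
        L2dot_pw (utt t) v + \sum_(c : cell M) cell_energy a c (uh t) v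
        = L2dot (f t) v].

End FineMesh.

Record coarse_mesh (R : realType) (M : fine_mesh R) := CoarseMesh {
  block : finType;
  blk : cell M -> block;
  _ : forall K, exists c, blk c = K;
  _ : forall K, connected (\bigcup_(c in [set c | blk c = K]) rect c)
}.

Arguments blk {R M} TH c : rename.

Section CoarseMesh.
Context {R : realType} {M : fine_mesh R} (TH : coarse_mesh M).
Implicit Types (K : block TH) (a : R * R -> R) (u v w : pwbilin M).

Definition inblk K : pred (cell M) := fun c => blk TH c == K.

Definition region K : set (R * R) :=
  \bigcup_(c in [set c | inblk K c]) rect c.

(* H, the maximum diameter of the coarse blocks *)
Definition coarse_size : R :=
  \big[Num.max/0]_(K : block TH)
    sup [set r | exists x y, [/\ region K x, region K y &
           r = Num.sqrt ((x.1 - y.1) ^+ 2 + (x.2 - y.2) ^+ 2)]].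

(* Functions on a single block K are extended by 0 to the other blocks. *)
Definition restrict K v : pwbilin M :=
  [ffun c => if inblk K c then v c else 0].

Definition VhK K v : Prop :=
  restrict K v = v /\ continuous_on (inblk K) v.

Definition Vh0K K v : Prop :=
  VhK K v /\
  forall c x, inblk K c -> rect c x -> frontier (region K) x -> ev v c x = 0.

Definition block_energy a K u v : R :=
  \sum_(c | inblk K c) cell_energy a c u v.

Definition VH1K a K w : Prop :=
  VhK K w /\ forall v, Vh0K K v -> block_energy a K w v = 0.

Definition VH1 a v : Prop := forall K, VH1K a K (restrict K v).

Definition boundary_dot K u v : R :=
  \sum_(c | inblk K c)
    \sum_(s : side | `[< sideset c s `<=` frontier (region K) >])
      side_int c s (fun x => ev u c x * ev v c x).

(* number of fine nodes on the boundary of K *)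
Definition boundary_nodes K : nat :=
  size (undup [seq x <- [seq corner c i | c <- enum (inblk K),
                                          i <- enum {: bool * bool}]
              | `[< frontier (region K) x >]]).

(* e 0, ..., e (n - 1) is a complete system of solutions in V of
   A (e i) v = (l i / k) B (e i) v for all v in V, B-orthonormal and with
   nondecreasing l; the index 0 corresponds to the first eigenvalue. *)
Definition eigensystem (V : pwbilin M -> Prop)
    (A B : pwbilin M -> pwbilin M -> R) (k : R) (n : nat)
    (l : nat -> R) (e : nat -> pwbilin M) : Prop :=
  [/\ forall i, (i < n)%N ->
        V (e i) /\ forall v, V v -> A (e i) v = l i / k * B (e i) v,
      forall i j, (i < n)%N -> (j < n)%N -> B (e i) (e j) = (i == j)%:R,
      forall i j, (i <= j < n)%N -> l i <= l j &
      forall v, V v -> v \in <<mkseq e n>>%VS].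

Definition boundary_eigensystem a K (mu : nat -> R) (w : nat -> pwbilin M)
    : Prop :=
  [/\ eigensystem (VH1K a K) (block_energy a K) (boundary_dot K)
        coarse_size (boundary_nodes K) mu w,
      mu 0%N = 0 &
      (1 < boundary_nodes K)%N -> 0 < mu 1%N].

Definition interior_eigensystem a K (nz : nat) (lam : nat -> R)
    (z : nat -> pwbilin M) : Prop :=
  eigensystem (Vh0K K) (block_energy a K) (@L2dot_pw R M)
    (coarse_size ^+ 2) nz lam z.

(* first p K functions w and first m K functions z on each block K *)
Definition VH (p m : block TH -> nat) (w z : block TH -> nat -> pwbilin M)
    (v : pwbilin M) : Prop :=
  forall K, restrict K v \in <<mkseq (w K) (p K) ++ mkseq (z K) (m K)>>%VS.

(* (K, Some K') is the interface of K and K', each unordered pair being taken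
   once with K^+ = K and K^- = K' (an empty interface contributes nothing to
   the sums over edges), and (K, None) is the part of the boundary of K
   contained in the frontier of Omega. *)
Definition edge := (block TH * option (block TH))%type.
Definition coarse_edge (e : edge) : bool :=
  if e.2 is Some K' then (enum_rank e.1 < enum_rank K')%N else true.

(* Integral over a coarse edge, split along the sides of fine cells that
   compose it. The integrand F c od s is evaluated on the side s of the cell c
   of K^+, with od the adjacent cell of K^-, if any; the unit normal pointing
   from K^+ to K^- (or outward) is there normal s. *)
Definition edge_int (Omega : set (R * R)) (e : edge)
    (F : cell M -> option (cell M) -> side -> R * R -> R) : R :=
  match e with
  | (K, Some K') =>
      \sum_(c | inblk K c) \sum_(d | inblk K' d)
        \sum_(s : side | `[< sideset c s = sideset d (opposite s) >])
          side_int c s (F c (Some d) s)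
  | (K, None) =>
      \sum_(c | inblk K c)
        \sum_(s : side | `[< sideset c s `<=` frontier Omega >])
          side_int c s (F c None s)
  end.

Definition avg (g : cell M -> R * R -> R) c (od : option (cell M)) x : R :=
  if od is Some d then (g c x + g d x) / 2 else g c x.
Definition jump (g : cell M -> R * R -> R) c (od : option (cell M)) x : R :=
  if od is Some d then g c x - g d x else g c x.

Definition flux a u (s : side) c x : R :=
  a x * (pd1 (ev u c) x * (normal s).1 + pd2 (ev u c) x * (normal s).2).

Definition aDG (Omega : set (R * R)) a (gamma : R) u v : R :=
  \sum_(K : block TH) block_energy a K u v
  + \sum_(e : edge | coarse_edge e)
      (- edge_int Omega e
           (fun c od s x => avg (flux a u s) c od x * jump (ev v) c od x)
       - edge_int Omega e
           (fun c od s x => avg (flux a v s) c od x * jump (ev u) c od x)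
       + gamma / fine_size M * edge_int Omega e
           (fun c od s x => a x * jump (ev u) c od x * jump (ev v) c od x)).

Definition anorm (Omega : set (R * R)) a (gamma : R) u : R :=
  Num.sqrt (\sum_(K : block TH) block_energy a K u u
    + gamma / fine_size M * \sum_(e : edge | coarse_edge e)
        edge_int Omega e
          (fun c od s x => (Num.sqrt (a x) * jump (ev u) c od x) ^+ 2)).

Definition penalty (Omega : set (R * R)) a (gamma : R) : Prop :=
  0 < gamma /\
  forall u v, (forall K, VhK K (restrict K u)) ->
    (forall K, VhK K (restrict K v)) ->
    anorm Omega a gamma v ^+ 2 / 2 <= aDG Omega a gamma v v /\
    aDG Omega a gamma u v <= 2 * anorm Omega a gamma u * anorm Omega a gamma v.

(* R_{u_h}(v) at a fixed time, with g = f(t), w = u_h(t), wtt = u_h''(t) *)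
Definition residual (Omega : set (R * R)) a (gamma : R)
    (g : R * R -> R) (w wtt v : pwbilin M) : R :=
  L2dot g v - L2dot_pw wtt v - aDG Omega a gamma w v.

Definition consistency (Omega : set (R * R)) a (gamma : R)
    (g : R * R -> R) (w wtt : pwbilin M) (Cuf : R) : Prop :=
  forall v, VH1 a v ->
    `|residual Omega a gamma g w wtt v|
      <= Cuf * fine_size M * anorm Omega a gamma v.

End CoarseMesh.

Arguments boundary_eigensystem {R M TH} a K mu w.
Arguments interior_eigensystem {R M TH} a K nz lam z.
Arguments boundary_nodes {R M TH} K.

(* Main.v *)
Require Import Defs.
From HB Require Import structures.
From mathcomp Require Import all_boot all_order all_algebra.
From mathcomp Require Import all_classical all_reals all_analysis.
From mathcomp Require Import measurable_realfun ring lra.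
Set Implicit Arguments.
Unset Strict Implicit.
Unset Printing Implicit Defensive.
Import Order.TTheory GRing.Theory Num.Theory.
Import numFieldNormedType.Exports.
Local Open Scope classical_set_scope.
Local Open Scope ring_scope.

(* A function of V_H splits blockwise into a harmonic part in V_H^1 and an
   interior part vanishing on the block boundaries. The interior part belongs
   to V_h, and neither it nor u_h jumps across coarse edges, so the residual
   vanishes on it by the fine-grid scheme; the consistency bound on V_H^1 thus
   extends to V_H, because the two parts are energy orthogonal on each block and
   only the harmonic one jumps. Coercivity and continuity of a_DG applied to
   w_H - v then give ||w_H - v||_a <= 4 ||u_h - v||_a + 2 h C(u, f). *)

(** * Quadratic forms *)

Section AbstractForm.
Context {R : rcfType} {V : lmodType R} (B : V -> V -> R).
Hypothesis BP : forall k u v w, B (k *: u + v) w = k * B u w + B v w.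
Hypothesis BC : forall u v, B u v = B v u.
Hypothesis B_ge0 : forall u, 0 <= B u u.

(* The crude factor 2 suffices and needs only the parallelogram identity, not
   Cauchy-Schwarz. *)
Lemma form_normB_le u v :
  Num.sqrt (B (u - v) (u - v))
    <= 2 * (Num.sqrt (B u u) + Num.sqrt (B v v)).
Proof.
have E k : B (k *: v + u) (k *: v + u)
    = k ^+ 2 * B v v + 2 * k * B u v + B u u.
  by rewrite BP [B v _]BC BP [B u (_ + _)]BC BP (BC v u); ring.
have := E 1; have := E (-1); rewrite scaleN1r [- v + u]addrC.
have := B_ge0 (1 *: v + u).
have := sqr_sqrtr (B_ge0 u); have := sqr_sqrtr (B_ge0 v).
have := sqr_sqrtr (B_ge0 (u - v)).
have := sqrtr_ge0 (B u u); have := sqrtr_ge0 (B v v).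
have := sqrtr_ge0 (B (u - v) (u - v)).
set x := Num.sqrt _; set y := Num.sqrt _; set z := Num.sqrt _.
(* The identity at [k = 1] and [k = -1] gives x^2 <= 2 (y^2 + z^2), which is at most (2 (y + z))^2;
   the square root is then taken by monotonicity. *)
by move=> *; rewrite -(ler_pXn2r (n := 2)) ?nnegrE//; nra.
Qed.

(** Pythagoras: the cross terms vanish and [B v v] is nonnegative. It serves to discard the interior
    part of a function of V_H. *)
Lemma form_orth_le u v : B u v = 0 -> B u u <= B (u + v) (u + v).
Proof.
move=> uv; rewrite -[X in X + _]scale1r BP [B v _]BC BP [B u (_ + _)]BC BP.
by rewrite [B v u]BC uv !mul1r addr0 add0r lerDl.
Qed.

End AbstractForm.

(** Dividing by [p] turns coercivity plus continuity into a norm bound; the case [p = 0] is treated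
    apart. *)
Lemma quadratic_le_linear (R : realFieldType) (p d r : R) :
  0 <= p -> 0 <= d -> 0 <= r ->
  p ^+ 2 / 2 <= 2 * d * p + r * p -> p <= 4 * d + 2 * r.
Proof.
move=> p0 d0 r0 h; have [/eqP->|pn0] := boolP (p == 0); first by lra.
have pp : 0 < p by rewrite lt_neqAle eq_sym pn0.
by rewrite -(ler_pM2r pp); nra.
Qed.

(** * Integrability on cells and sides *)

Section BoundedMeasurable.
Context {R : realType} {d : measure_display} {T : measurableType d}.
Implicit Types (D : set T) (f g : T -> R).

(** A class closed under sums and products, and integrable on sets of finite measure. It contains
    the coefficient and all piecewise polynomial data, so the side conditions of linearity of the
    integral follow from the shape of the integrand. *)
Definition bounded_measurable D g : Prop :=
  measurable_fun D g /\ exists M : R, forall x, D x -> `|g x| <= M.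

Lemma bounded_measurable_cst D (k : R) : bounded_measurable D (fun=> k).
Proof. by split; [exact: measurable_cst | exists `|k|]. Qed.

Lemma bounded_measurableD D f g : bounded_measurable D f ->
  bounded_measurable D g -> bounded_measurable D (fun x => f x + g x).
Proof.
move=> [mf [M hM]] [mg [N hN]]; split; first exact: measurable_funD.
exists (M + N) => x Dx.
exact: le_trans (ler_normD _ _) (lerD (hM _ Dx) (hN _ Dx)).
Qed.

Lemma bounded_measurableM D f g : bounded_measurable D f ->
  bounded_measurable D g -> bounded_measurable D (fun x => f x * g x).
Proof.
move=> [mf [M hM]] [mg [N hN]]; split; first exact: measurable_funM.
exists (M * N) => x Dx; rewrite normrM.
by apply: ler_pM => //; [exact: hM | exact: hN].
Qed.

Lemma bounded_measurableB D f g : bounded_measurable D f ->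
  bounded_measurable D g -> bounded_measurable D (fun x => f x - g x).
Proof.
move=> [mf [M hM]] [mg [N hN]]; split; first exact: measurable_funB.
exists (M + N) => x Dx.
exact: le_trans (ler_normB _ _) (lerD (hM _ Dx) (hN _ Dx)).
Qed.

Lemma bounded_measurableS (D E : set T) f : measurable E -> D `<=` E ->
  bounded_measurable E f -> bounded_measurable D f.
Proof.
move=> mE DE [mf [M hM]]; split; first exact: measurable_funS mf.
by exists M => x /DE; exact: hM.
Qed.

Lemma bounded_measurable_integrable
    (mu : {measure set T -> \bar R}) D f :
  measurable D -> (mu D < +oo)%E -> bounded_measurable D f ->
  mu.-integrable D (EFin \o f).
Proof.
move=> mD fD [mf [M hM]]; apply: measurable_bounded_integrable => //.
exists M; split; first exact: num_real.
by move=> N MN x Dx; apply: le_trans (ltW MN); exact: hM.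
Qed.

(* |g f| <= g^2 + f^2, and f^2 is bounded on a set of finite measure. *)
Lemma square_integrableM (mu : {measure set T -> \bar R}) D g f :
  measurable D -> (mu D < +oo)%E -> measurable_fun D g ->
  mu.-integrable D (fun x => (g x ^+ 2)%:E) -> bounded_measurable D f ->
  mu.-integrable D (EFin \o (fun x => g x * f x)).
Proof.
move=> mD fD mg ig bf.
have if2 := bounded_measurable_integrable mD fD (bounded_measurableM bf bf).
apply: le_integrable (integrableD mD ig if2) => //.
  by apply/measurable_EFinP; apply: measurable_funM => //; case: bf.
move=> x Dx /=; rewrite lee_fin normrM.
rewrite [leRHS]ger0_norm; last by rewrite addr_ge0 ?sqr_ge0 -?expr2 ?sqr_ge0.
rewrite -expr2 -[g x ^+ 2]real_normK ?num_real//.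
rewrite -[f x ^+ 2]real_normK ?num_real//.
have := sqr_ge0 (`|g x| - `|f x|); have := sqr_ge0 `|g x|.
have := sqr_ge0 `|f x|; nra.
Qed.

End BoundedMeasurable.

Section PlaneMeasure.
Context {R : realType}.
Implicit Types (U : set (R * R)) (x : R * R).

(** The sigma-algebra of the plane is the product one, so an open set is written as the countable
    union of the open squares with rational centre and radius that it contains. *)
Lemma open_plane_measurable U : open U -> measurable U.
Proof.
move=> oU.
pose B (p q : rat) (r : rat) : set (R * R) :=
  `]ratr p - ratr r, ratr p + ratr r[ `*` `]ratr q - ratr r, ratr q + ratr r[.
have -> : U = \bigcup_p \bigcup_q \bigcup_r
    (if `[< B p q r `<=` U >] then B p q r else set0).
  apply/seteqP; split => [x Ux|x [p _ [q _ [r _]]]]; last first.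
    by case: asboolP => // BU /BU.
  have /nbhs_ballP[e /= e0 eU] := open_nbhs_nbhs (conj oU Ux).
  (* A radius below [e / 2] suffices: in each coordinate the centre is closer than the radius both
     to [x] and to any point of the square. *)
  have [r] := @rat_in_itvoo R 0 (e / 2) ltac:(by rewrite divr_gt0).
  rewrite in_itv /= => /andP[r0 re].
  have approx (y : R) : exists p : rat, `|y - ratr p| < ratr r.
    have [|p] := @rat_in_itvoo R (y - ratr r) (y + ratr r); first by lra.
    by rewrite in_itv /= => hp; exists p; rewrite ltr_distlC.
  have [p hp] := approx x.1; have [q hq] := approx x.2.
  exists p => //; exists q => //; exists r => //; rewrite asboolT.
    by split; rewrite /= in_itv /= -ltr_distlC distrC.
  have near (s t c : R) : `|s - c| < ratr r ->
      t \in `]c - ratr r, c + ratr r[ ->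
      `|s - t| < e.
    rewrite in_itv /= -ltr_distl => sc tc.
    apply: le_lt_trans (ler_distD c _ _) _; rewrite [`|c - t|]distrC; lra.
  by move=> y [/= h1 h2]; apply: eU; split; [exact: near h1 | exact: near h2].
do 3 (apply: bigcupT_measurable_rat => ?).
case: ifP => _ //; exact: measurableX.
Qed.

End PlaneMeasure.

Section Bilinear.
Context {R : realType}.
Implicit Types (q : 'rV[R]_4) (x : R * R).

Lemma derive1_affine (b m s : R) : derive1 (fun r : R => b + m * r) s = m.
Proof.
rewrite derive1E (_ : (fun r => _) = cst b + m \*: id) //.
by rewrite deriveD// derive_cst deriveZ// derive_id add0r scaler1.
Qed.

Lemma pd1_bilin q x : pd1 (bilin q) x = q 0 1 + q 0 3 * x.2.
Proof.
rewrite /pd1 (_ : (fun s => _) =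
  (fun s => (q 0 0 + q 0 2 * x.2) + (q 0 1 + q 0 3 * x.2) * s)).
  exact: derive1_affine.
by apply/funext => s; rewrite /bilin /=; ring.
Qed.

Lemma pd2_bilin q x : pd2 (bilin q) x = q 0 2 + q 0 3 * x.1.
Proof.
rewrite /pd2 (_ : (fun s => _) =
  (fun s => (q 0 0 + q 0 1 * x.1) + (q 0 2 + q 0 3 * x.1) * s)).
  exact: derive1_affine.
by apply/funext => s; rewrite /bilin /=; ring.
Qed.

Lemma bilinP (k : R) q q' x :
  bilin (k *: q + q') x = k * bilin q x + bilin q' x.
Proof. by rewrite /bilin !mxE; ring. Qed.

End Bilinear.

Section CellIntegrals.
Context {R : realType} (M : fine_mesh R).
Implicit Types (u v w : pwbilin M) (c d : cell M) (k : R) (x : R * R).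
Implicit Types (g h : R * R -> R).

Lemma lo_lt_hi c : (lo c).1 < (hi c).1 /\ (lo c).2 < (hi c).2.
Proof. by case: M c => ? ? ? H ? c; exact: H. Qed.

(** Linearity is stated throughout for [k *: u + v]: sums are the case [k = 1], differences the case
    [k = -1]. *)
Lemma evP k u v c x : ev (k *: u + v) c x = k * ev u c x + ev v c x.
Proof. by rewrite /ev !ffunE bilinP. Qed.

Lemma evD u v c x : ev (u + v) c x = ev u c x + ev v c x.
Proof. by rewrite -[u]scale1r evP mul1r scale1r. Qed.

Lemma pd1_evP k u v c x :
  pd1 (ev (k *: u + v) c) x = k * pd1 (ev u c) x + pd1 (ev v c) x.
Proof. by rewrite !pd1_bilin !ffunE !mxE; ring. Qed.

Lemma pd2_evP k u v c x :
  pd2 (ev (k *: u + v) c) x = k * pd2 (ev u c) x + pd2 (ev v c) x.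
Proof. by rewrite !pd2_bilin !ffunE !mxE; ring. Qed.

Lemma fluxP (a : R * R -> R) k u v s c x :
  flux a (k *: u + v) s c x = k * flux a u s c x + flux a v s c x.
Proof. by rewrite /flux pd1_evP pd2_evP; ring. Qed.

Lemma ev0 c x : ev (0 : pwbilin M) c x = 0.
Proof. by rewrite /ev /bilin ffunE !mxE; ring. Qed.

Lemma rectE c :
  rect c = `[(lo c).1, (hi c).1] `*` `[(lo c).2, (hi c).2].
Proof. by apply/seteqP; split => x /=; rewrite !in_itv. Qed.

Lemma measurable_rect c : measurable (rect c).
Proof. by rewrite rectE; exact: measurableX. Qed.

Lemma measurable_rect_int c : measurable (rect c)°.
Proof. by apply: open_plane_measurable; exact: open_interior. Qed.

Lemma area_rect_int_fin c : (area (rect c)° < +oo)%E.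
Proof.
have [h1 h2] := lo_lt_hi c.
apply: (@le_lt_trans _ _ (area (rect c))).
  apply: le_measure; rewrite ?inE.
  - exact: measurable_rect_int.
  - exact: measurable_rect.
  - exact: interior_subset.
rewrite rectE product_measure1E//.
rewrite /= !lebesgue_measure_itv /= !lte_fin h1 h2.
by rewrite -!EFinB -EFinM ltry.
Qed.

Lemma bounded_measurable_fst c : bounded_measurable (rect c) (@fst R R).
Proof.
split; first by apply: measurable_funTS; exact: measurable_fst.
exists (`|(lo c).1| + `|(hi c).1|) => x [/andP[h1 h2] _].
have := ler_norm (hi c).1; have := ler_norm (- (lo c).1); rewrite normrN.
by move=> *; rewrite ler_norml; apply/andP; split; have := normr_ge0 (hi c).1;
  have := normr_ge0 (lo c).1; lra.
Qed.

Lemma bounded_measurable_snd c : bounded_measurable (rect c) (@snd R R).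
Proof.
split; first by apply: measurable_funTS; exact: measurable_snd.
exists (`|(lo c).2| + `|(hi c).2|) => x [_ /andP[h1 h2]].
have := ler_norm (hi c).2; have := ler_norm (- (lo c).2); rewrite normrN.
by move=> *; rewrite ler_norml; apply/andP; split; have := normr_ge0 (hi c).2;
  have := normr_ge0 (lo c).2; lra.
Qed.

#[local] Hint Resolve bounded_measurable_fst bounded_measurable_snd
  bounded_measurable_cst : core.

Lemma bounded_measurable_ev c v d : bounded_measurable (rect c) (ev v d).
Proof.
by do ![apply: bounded_measurableD | apply: bounded_measurableM].
Qed.

Lemma bounded_measurable_pd1 c v d :
  bounded_measurable (rect c) (pd1 (ev v d)).
Proof.
rewrite (_ : pd1 _ = (fun x => v d 0 1 + v d 0 3 * x.2)).
  by do ![apply: bounded_measurableD | apply: bounded_measurableM].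
by apply/funext => x; rewrite pd1_bilin.
Qed.

Lemma bounded_measurable_pd2 c v d :
  bounded_measurable (rect c) (pd2 (ev v d)).
Proof.
rewrite (_ : pd2 _ = (fun x => v d 0 2 + v d 0 3 * x.1)).
  by do ![apply: bounded_measurableD | apply: bounded_measurableM].
by apply/funext => x; rewrite pd2_bilin.
Qed.

Lemma cell_intP k g h c :
  bounded_measurable (rect c) g -> bounded_measurable (rect c) h ->
  cell_int c (fun x => k * g x + h x) = k * cell_int c g + cell_int c h.
Proof.
have sub := @interior_subset _ (rect c).
move=> /(bounded_measurableS (measurable_rect c) sub) mg.
move=> /(bounded_measurableS (measurable_rect c) sub) mh.
have mD := measurable_rect_int c; have fD := area_rect_int_fin c.
rewrite /cell_int RintegralD ?RintegralZl//.
- exact: bounded_measurable_integrable.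
- apply: bounded_measurable_integrable => //.
  exact: bounded_measurableM.
- exact: bounded_measurable_integrable.
Qed.

Lemma side_intP k g h c s :
  bounded_measurable (rect c) g -> bounded_measurable (rect c) h ->
  side_int c s (fun x => k * g x + h x) = k * side_int c s g + side_int c s h.
Proof.
have [h1 h2] := lo_lt_hi c.
have corner1 b : (lo c).1 <= (corner c (b, b)).1 <= (hi c).1.
  by case: b => /=; rewrite lexx ltW.
have corner2 b : (lo c).2 <= (corner c (b, b)).2 <= (hi c).2.
  by case: b => /=; rewrite lexx ltW.
have fin (r t : R) : (lebesgue_measure `[r, t] < +oo)%E.
  rewrite lebesgue_measure_itv /= lte_fin.
  by case: ifP => // _; rewrite -EFinB ltry.
(* Restriction to a side is composition with a measurable embedding of an interval into the cell,
   which preserves boundedness and measurability. *)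
have sec (i : R -> R * R) r t f : measurable_fun setT i ->
    (forall y, y \in `[r, t] -> rect c (i y)) ->
    bounded_measurable (rect c) f -> bounded_measurable `[r, t] (f \o i).
  move=> mi ic [mf [N hN]]; split; last first.
    by exists N => y /ic; exact: hN.
  apply: (measurable_comp (measurable_rect c)) => //.
    by move=> _ [y /ic yc <-].
  exact: measurable_funTS.
rewrite /side_int; case: ifP => _ bg bh.
  have it f : bounded_measurable (rect c) f ->
      (@lebesgue_measure R).-integrable `[(lo c).1, (hi c).1]
        (EFin \o (fun r => f (r, (corner c (s.2, s.2)).2))).
    move=> bf; apply: bounded_measurable_integrable => //.
      exact: fin.
    apply: sec bf; first exact: pair2_measurable.
    by move=> y; rewrite in_itv /= => hy; split => //; exact: corner2.
  rewrite RintegralD ?RintegralZl//; try exact: it.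
  by apply: (it (fun x => k * g x)); apply: bounded_measurableM.
have it f : bounded_measurable (rect c) f ->
    (@lebesgue_measure R).-integrable `[(lo c).2, (hi c).2]
      (EFin \o (fun r => f ((corner c (s.2, s.2)).1, r))).
  move=> bf; apply: bounded_measurable_integrable => //.
    exact: fin.
  apply: sec bf; first exact: pair1_measurable.
  by move=> y; rewrite in_itv /= => hy; split => //; exact: corner1.
rewrite RintegralD ?RintegralZl//; try exact: it.
by apply: (it (fun x => k * g x)); apply: bounded_measurableM.
Qed.

Lemma eq_side_int c s g h : (forall x, sideset c s x -> g x = h x) ->
  side_int c s g = side_int c s h.
Proof.
have [h1 h2] := lo_lt_hi c.
move=> gh; rewrite /side_int; case: s gh => [] [] b /= gh;
  apply: eq_Rintegral => r; rewrite inE /= in_itv /= => hr; apply: gh;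
  (split; [split | ]) => //=; case: b => /=; rewrite lexx ltW//.
Qed.

Lemma side_int_ge0 c s g : (forall x, sideset c s x -> 0 <= g x) ->
  0 <= side_int c s g.
Proof.
(* The absolute value agrees with [g] on the side and is nonnegative everywhere. *)
move=> g0; rewrite (@eq_side_int _ _ _ (fun x => `|g x|)); last first.
  by move=> x /g0 /ger0_norm.
by rewrite /side_int; case: ifP => _; exact: Rintegral_ge0.
Qed.

Lemma eq_cell_int c g h : (forall x, (rect c)° x -> g x = h x) ->
  cell_int c g = cell_int c h.
Proof. by move=> gh; apply: eq_Rintegral => x; rewrite inE; exact: gh. Qed.

Lemma L2dot_pwD w u v : L2dot_pw w (u + v) = L2dot_pw w u + L2dot_pw w v.
Proof.
rewrite /L2dot_pw -big_split /=; apply: eq_bigr => c _.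
rewrite -[cell_int c (fun x => _ * ev u c x)]mul1r -cell_intP;
  do ?[apply: bounded_measurableM|exact: bounded_measurable_ev].
by apply: eq_cell_int => x _; rewrite evD; ring.
Qed.

End CellIntegrals.

(** * Frontiers of coarse blocks *)

Section MeshGeometry.
Context {R : realType} {M : fine_mesh R} (TH : coarse_mesh M).
Implicit Types (c d : cell M) (K : block TH) (x y : R * R).

(** Strict inequalities instead of a topological interior, so that coordinates can be compared
    directly. *)
Definition open_cell d : set (R * R) :=
  [set y | (lo d).1 < y.1 < (hi d).1 /\ (lo d).2 < y.2 < (hi d).2].

(** By conformity a common point of two distinct cells is a corner of [d] or lies on a side of [d],
    so one of its coordinates is an endpoint, against the strict inequalities. *)
Lemma open_cell_disjoint c d y : c != d -> rect c y -> ~ open_cell d y.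
Proof.
move=> cd cy [/andP[h1 h2] /andP[h3 h4]].
have dy : rect d y by split; rewrite !ltW.
have yI : (rect c `&` rect d) y by [].
(* This is the conformity condition of [fine_mesh], an unnamed field recovered by destructing
   [M]. *)
have [I0|[i [j [Icd ij]]]|[s [Icd sd]]] :
    [\/ rect c `&` rect d = set0,
        exists i j, rect c `&` rect d = [set corner c i]
                    /\ corner c i = corner d j |
        exists s, rect c `&` rect d = sideset c s
                  /\ sideset c s = sideset d (opposite s)].
- by case: M c d {yI dy h1 h2 h3 h4 cy} cd => ? ? ? ? H c d; exact: H.
- by move: yI; rewrite I0.
- move: yI; rewrite Icd ij /= => yE; move: h1 h2.
  by rewrite yE /corner /=; case: ifP => _; rewrite ltxx.
- move: yI; rewrite Icd sd => -[_]; rewrite /opposite /=.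
  case: s.1; case: (~~ s.2) => /= yE; move: h1 h2 h3 h4; rewrite yE;
    by rewrite ltxx.
Qed.

Lemma itvoo_approx (l r s e : R) : l < r -> l <= s <= r -> 0 < e ->
  exists2 t, l < t < r & `|s - t| < e.
Proof.
move=> lr /andP[ls sr] e0.
(* The midpoint of the intersection of the intervals (l, r) and (s - e, s + e). *)
exists ((Num.max l (s - e) + Num.min r (s + e)) / 2).
  by apply/andP; split; case: (leP l (s - e)); case: (leP r (s + e)); lra.
by rewrite ltr_distlC; apply/andP; split;
  case: (leP l (s - e)); case: (leP r (s + e)); lra.
Qed.

Lemma nbhs_rect_open_cell d x (U : set (R * R)) : rect d x -> nbhs x U ->
  exists2 y, U y & open_cell d y.
Proof.
move=> [hx1 hx2] /nbhs_ballP[e /= e0 eU]; have [l1 l2] := lo_lt_hi d.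
have [t1 ? ?] := itvoo_approx l1 hx1 e0.
have [t2 ? ?] := itvoo_approx l2 hx2 e0.
by exists (t1, t2); [apply: eU | ].
Qed.

(** A neighbourhood of [x] inside the region of [K] would meet the open cell of [d], giving a point
    shared with a cell of [K], hence with a cell distinct from [d]. *)
Lemma frontier_region_shared K c d x : inblk K c -> ~~ inblk K d ->
  rect c x -> rect d x -> frontier (region K) x.
Proof.
move=> Kc Kd cx dx; split; first by apply: subset_closure; exists c.
move=> /(nbhs_rect_open_cell dx)[y [c' /= Kc' c'y]].
by apply: open_cell_disjoint c'y; apply: contraNneq Kd => <-.
Qed.

Variable Omega : set (R * R).
Hypothesis part : fine_partition M Omega.

(** An interior point of a block is interior to the union of all cells, whose interior is [Omega],
    so it cannot lie on the frontier of [Omega]. *)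
Lemma frontier_region_domain K c x : inblk K c -> rect c x ->
  frontier Omega x -> frontier (region K) x.
Proof.
move=> Kc cx [_ nO]; split; first by apply: subset_closure; exists c.
move=> Kx; apply: nO; rewrite part.2; apply: nbhs_interior.
by move: Kx; apply: interiorS => y [c' _ c'y]; exists c'.
Qed.

Lemma rect_sub_closure c : rect c `<=` closure Omega.
Proof. by have [-> _] := part => x cx; exists c. Qed.

Lemma rect_int_sub c : (rect c)° `<=` Omega.
Proof.
by rewrite part.2; apply: interiorS => x cx; exists c.
Qed.

Lemma measurable_partitioned : measurable Omega.
Proof.
by rewrite part.2; apply: open_plane_measurable; exact: open_interior.
Qed.

Lemma measurable_closure_partitioned : measurable (closure Omega).
Proof.
have [-> _] := part; apply: fin_bigcup_measurable; first exact: finite_finset.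
by move=> c _; exact: measurable_rect.
Qed.

Variables (a : R * R -> R) (a0 a1 : R).
Hypothesis coef : coefficient Omega a a0 a1.

Lemma bounded_measurable_coefficient c : bounded_measurable (rect c) a.
Proof.
have [a0_gt0 _ ma aB] := coef; have sub := @rect_sub_closure c.
split; first exact: measurable_funS measurable_closure_partitioned sub ma.
exists a1 => x /sub /aB /andP[h1 h2].
by rewrite ger0_norm// (le_trans _ h1)// ltW.
Qed.

Lemma coefficient_ge0 c x : rect c x -> 0 <= a x.
Proof.
have [a0_gt0 _ _ aB] := coef.
by move=> /rect_sub_closure /aB /andP[h1 _]; rewrite (le_trans _ h1)// ltW.
Qed.

(** The source [g] is only square integrable, so integrability of its product with a bilinear
    function comes from [square_integrableM]. *)
Lemma L2dotD (g : R * R -> R) (u v : pwbilin M) : L2 Omega g ->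
  @L2dot R M g (u + v) = L2dot g u + L2dot g v.
Proof.
move=> [mg ig]; rewrite /L2dot -big_split /=; apply: eq_bigr => c _.
have sub := @rect_int_sub c; have mO := measurable_partitioned.
have mD := measurable_rect_int c; have fD := area_rect_int_fin c.
have it w : (area).-integrable (rect c)° (EFin \o (fun x => g x * ev w c x)).
  apply: square_integrableM => //.
  - exact: measurable_funS mg.
  - exact: integrableS ig.
  - apply: bounded_measurableS (bounded_measurable_ev c w c).
      exact: measurable_rect.
    exact: interior_subset.
rewrite /cell_int -RintegralD//; apply: eq_Rintegral => x _.
by rewrite evD mulrDr.
Qed.

End MeshGeometry.

(** * The interior penalty form *)

Section Forms.
Context {R : realType} {M : fine_mesh R} (TH : coarse_mesh M).
Variables (Omega : set (R * R)) (a : R * R -> R) (a0 a1 gamma : R).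
Hypothesis part : fine_partition M Omega.
Hypothesis coef : coefficient Omega a a0 a1.
Implicit Types (c d : cell M) (K : block TH) (e : edge TH) (u v w : pwbilin M).
Implicit Types (k : R) (x : R * R) (od : option (cell M)) (s : side).
Implicit Types F G : cell M -> option (cell M) -> side -> R * R -> R.

(* The configurations at which [edge_int] evaluates its integrand. *)
Definition on_edge e c od s x : Prop :=
  [/\ inblk e.1 c, sideset c s x &
      match e.2, od with
      | Some K', Some d => inblk K' d /\ sideset d (opposite s) x
      | None, None => frontier Omega x
      | _, _ => False
      end].

Lemma eq_edge_int e F G :
  (forall c od s x, on_edge e c od s x -> F c od s x = G c od s x) ->
  edge_int Omega e F = edge_int Omega e G.
Proof.
case: e => K [K'|] FG /=; apply: eq_bigr => c Kc.
  apply: eq_bigr => d Kd; apply: eq_bigr => s /asboolP cd.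
  by apply: eq_side_int => x cx; apply: FG; split => //=; rewrite -cd.
apply: eq_bigr => s /asboolP cO; apply: eq_side_int => x cx.
by apply: FG; split => //=; exact: cO.
Qed.

Lemma edge_int_ge0 e F :
  (forall c od s x, on_edge e c od s x -> 0 <= F c od s x) ->
  0 <= edge_int Omega e F.
Proof.
case: e => K [K'|] F0 /=; apply: sumr_ge0 => c Kc.
  apply: sumr_ge0 => d Kd; apply: sumr_ge0 => s /asboolP cd.
  by apply: side_int_ge0 => x cx; apply: F0; split => //=; rewrite -cd.
apply: sumr_ge0 => s /asboolP cO; apply: side_int_ge0 => x cx.
by apply: F0; split => //=; exact: cO.
Qed.

Lemma edge_intP k e F G :
  (forall c od s, bounded_measurable (rect c) (F c od s)) ->
  (forall c od s, bounded_measurable (rect c) (G c od s)) ->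
  edge_int Omega e (fun c od s x => k * F c od s x + G c od s x)
    = k * edge_int Omega e F + edge_int Omega e G.
Proof.
move=> bF bG; case: e => K [K'|] /=;
  rewrite mulr_sumr -big_split; apply: eq_bigr => c _ /=.
  rewrite mulr_sumr -big_split; apply: eq_bigr => d _ /=.
  by rewrite mulr_sumr -big_split; apply: eq_bigr => s _; exact: side_intP.
by rewrite mulr_sumr -big_split; apply: eq_bigr => s _; exact: side_intP.
Qed.

Lemma edge_int0 e F :
  (forall c od s x, on_edge e c od s x -> F c od s x = 0) ->
  edge_int Omega e F = 0.
Proof.
move=> F0; rewrite (@eq_edge_int e _ (fun _ _ _ => cst 0))//.
(* If I is the integral of the zero function, linearity gives I + I = I. *)
apply/eqP; rewrite -(inj_eq (addrI (edge_int Omega e (fun _ _ _ => cst 0)))).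
rewrite -[X in X + _]mul1r -edge_intP.
- by rewrite addr0; apply/eqP; apply: eq_edge_int => c od s x _ /=; ring.
- by move=> *; exact: bounded_measurable_cst.
- by move=> *; exact: bounded_measurable_cst.
Qed.

Lemma jumpP k u v c od x :
  jump (ev (k *: u + v)) c od x = k * jump (ev u) c od x + jump (ev v) c od x.
Proof. by case: od => [d|]; rewrite /jump !evP; ring. Qed.

Lemma avg_fluxP k u v s c od x :
  avg (flux a (k *: u + v) s) c od x
    = k * avg (flux a u s) c od x + avg (flux a v s) c od x.
Proof. by case: od => [d|]; rewrite /avg !fluxP; field. Qed.

Lemma bounded_measurable_jump c u od :
  bounded_measurable (rect c) (jump (ev u) c od).
Proof.
case: od => [d|]; rewrite /jump; last exact: bounded_measurable_ev.
apply: bounded_measurableB; exact: bounded_measurable_ev.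
Qed.

(** The cell [d] may differ from [c]: its bilinear piece is a polynomial on the whole plane, hence
    bounded on [rect c] as well. *)
Lemma bounded_measurable_flux c u s d :
  bounded_measurable (rect c) (flux a u s d).
Proof.
apply: bounded_measurableM; first exact: bounded_measurable_coefficient coef _.
by apply: bounded_measurableD; apply: bounded_measurableM;
  [exact: bounded_measurable_pd1 | exact: bounded_measurable_cst
  | exact: bounded_measurable_pd2 | exact: bounded_measurable_cst].
Qed.

Lemma bounded_measurable_avg_flux c u s od :
  bounded_measurable (rect c) (avg (flux a u s) c od).
Proof.
case: od => [d|]; rewrite /avg; last exact: bounded_measurable_flux.
apply: bounded_measurableM; last exact: bounded_measurable_cst.
apply: bounded_measurableD; exact: bounded_measurable_flux.
Qed.

Lemma cell_energyP k u v w c :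
  cell_energy a c (k *: u + v) w
    = k * cell_energy a c u w + cell_energy a c v w.
Proof.
have bm u' v' : bounded_measurable (rect c)
    (fun x => a x * (pd1 (ev u' c) x * pd1 (ev v' c) x
                     + pd2 (ev u' c) x * pd2 (ev v' c) x)).
  apply: bounded_measurableM; first exact: bounded_measurable_coefficient coef _.
  by apply: bounded_measurableD; apply: bounded_measurableM;
    [exact: bounded_measurable_pd1 | exact: bounded_measurable_pd1
    | exact: bounded_measurable_pd2 | exact: bounded_measurable_pd2].
rewrite /cell_energy -cell_intP//; apply: eq_cell_int => x _.
by rewrite pd1_evP pd2_evP; ring.
Qed.

Lemma cell_energyC u v c : cell_energy a c u v = cell_energy a c v u.
Proof. by apply: eq_cell_int => x _; congr (_ * (_ + _)); rewrite mulrC. Qed.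

Lemma cell_energy_ge0 u c : 0 <= cell_energy a c u u.
Proof.
apply: Rintegral_ge0 => x /interior_subset cx.
rewrite mulr_ge0 ?(coefficient_ge0 part coef cx)//.
by rewrite addr_ge0// -expr2 sqr_ge0.
Qed.

Lemma block_energyP K k u v w :
  block_energy a K (k *: u + v) w
    = k * block_energy a K u w + block_energy a K v w.
Proof.
rewrite /block_energy mulr_sumr -big_split; apply: eq_bigr => c _ /=.
exact: cell_energyP.
Qed.

Lemma block_energyC K u v : block_energy a K u v = block_energy a K v u.
Proof. by apply: eq_bigr => c _; exact: cell_energyC. Qed.

Lemma block_energy_ge0 K u : 0 <= block_energy a K u u.
Proof. by apply: sumr_ge0 => c _; exact: cell_energy_ge0. Qed.

Lemma block_energy_restrict K u v :
  block_energy a K u v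
    = block_energy a K (Defs.restrict K u) (Defs.restrict K v).
Proof.
apply: eq_bigr => c Kc; rewrite /cell_energy /ev !ffunE.
by rewrite (Kc : inblk K c = true).
Qed.

Definition penalty_form u v : R :=
  \sum_(e : edge TH | coarse_edge e) edge_int Omega e
    (fun c od s x => a x * jump (ev u) c od x * jump (ev v) c od x).

(** One of the two consistency terms of a_DG; the other is its transpose, whence the symmetry of
    a_DG. *)
Definition flux_form u v : R :=
  \sum_(e : edge TH | coarse_edge e) edge_int Omega e
    (fun c od s x => avg (flux a u s) c od x * jump (ev v) c od x).

(* The inner product associated with [anorm]. *)
Definition energy_form u v : R :=
  \sum_(K : block TH) block_energy a K u v
  + gamma / fine_size M * penalty_form u v.

Lemma aDGE u v :
  aDG TH Omega a gamma u v = energy_form u v - flux_form u v - flux_form v u.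
Proof.
rewrite /aDG /energy_form /penalty_form /flux_form mulr_sumr !big_split /=.
by rewrite !sumrN; ring.
Qed.

Lemma anormE u : anorm TH Omega a gamma u = Num.sqrt (energy_form u u).
Proof.
congr (Num.sqrt (_ + _ * _)); apply: eq_bigr => e _.
apply: eq_edge_int => c od s x [_ [cx _] _].
by rewrite exprMn sqr_sqrtr ?(coefficient_ge0 part coef cx)// expr2 mulrA.
Qed.

Lemma penalty_formP k u v w :
  penalty_form (k *: u + v) w = k * penalty_form u w + penalty_form v w.
Proof.
rewrite /penalty_form mulr_sumr -big_split; apply: eq_bigr => e _ /=.
rewrite -edge_intP.
- by apply: eq_edge_int => c od s x _; rewrite jumpP; ring.
all: move=> c od s; apply: bounded_measurableM;
  last exact: bounded_measurable_jump.
all: by apply: bounded_measurableM;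
  [exact: bounded_measurable_coefficient coef _
  | exact: bounded_measurable_jump].
Qed.

Lemma flux_formPl k u v w :
  flux_form (k *: u + v) w = k * flux_form u w + flux_form v w.
Proof.
rewrite /flux_form mulr_sumr -big_split; apply: eq_bigr => e _ /=.
rewrite -edge_intP.
- by apply: eq_edge_int => c od s x _; rewrite avg_fluxP; ring.
all: by move=> c od s; apply: bounded_measurableM;
  [exact: bounded_measurable_avg_flux | exact: bounded_measurable_jump].
Qed.

Lemma flux_formPr k u v w :
  flux_form w (k *: u + v) = k * flux_form w u + flux_form w v.
Proof.
rewrite /flux_form mulr_sumr -big_split; apply: eq_bigr => e _ /=.
rewrite -edge_intP.
- by apply: eq_edge_int => c od s x _; rewrite jumpP; ring.
all: by move=> c od s; apply: bounded_measurableM;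
  [exact: bounded_measurable_avg_flux | exact: bounded_measurable_jump].
Qed.

Lemma penalty_formC u v : penalty_form u v = penalty_form v u.
Proof.
by apply: eq_bigr => e _; apply: eq_edge_int => c od s x _; rewrite mulrAC.
Qed.

Lemma penalty_form_ge0 u : 0 <= penalty_form u u.
Proof.
apply: sumr_ge0 => e _; apply: edge_int_ge0 => c od s x [_ [cx _] _].
by rewrite -mulrA mulr_ge0 ?(coefficient_ge0 part coef cx)// -expr2 sqr_ge0.
Qed.

Lemma energy_formP k u v w :
  energy_form (k *: u + v) w = k * energy_form u w + energy_form v w.
Proof.
have E : \sum_(K : block TH) block_energy a K (k *: u + v) w
    = k * (\sum_(K : block TH) block_energy a K u w)
      + \sum_(K : block TH) block_energy a K v w.
  rewrite mulr_sumr -big_split; apply: eq_bigr => K _ /=.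
  exact: block_energyP.
rewrite /energy_form [X in X + _ = _]E penalty_formP.
have lin (g A B P Q : R) : k * A + B + g * (k * P + Q)
    = k * (A + g * P) + (B + g * Q) by ring.
exact: lin.
Qed.

Lemma energy_formC u v : energy_form u v = energy_form v u.
Proof.
apply: (congr2 +%R); first by apply: eq_bigr => K _; exact: block_energyC.
by apply: (congr1 ( *%R _)); exact: penalty_formC.
Qed.

Lemma aDGPl k u v w : aDG TH Omega a gamma (k *: u + v) w
  = k * aDG TH Omega a gamma u w + aDG TH Omega a gamma v w.
Proof.
rewrite !aDGE energy_formP flux_formPl flux_formPr.
have lin (A B F G H I : R) : k * A + B - (k * F + G) - (k * H + I)
    = k * (A - F - H) + (B - G - I) by ring.
exact: lin.
Qed.

Lemma aDGC u v : aDG TH Omega a gamma u v = aDG TH Omega a gamma v u.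
Proof. by rewrite [LHS]aDGE [RHS]aDGE [in LHS]energy_formC [LHS]addrAC. Qed.

Hypothesis gamma_ge0 : 0 <= gamma.

Lemma fine_size_ge0 : 0 <= fine_size M.
Proof.
apply: (big_ind (fun r => 0 <= r)) => [//|r t r0 _|c _]; rewrite le_max ?r0//.
by rewrite subr_ge0 ltW//; case: (lo_lt_hi c).
Qed.

Lemma energy_form_ge0 u : 0 <= energy_form u u.
Proof.
rewrite addr_ge0 ?sumr_ge0// => [K _|]; first exact: block_energy_ge0.
by rewrite mulr_ge0 ?divr_ge0 ?fine_size_ge0 ?penalty_form_ge0.
Qed.

Lemma anorm_ge0 u : 0 <= anorm TH Omega a gamma u.
Proof. exact: sqrtr_ge0. Qed.

Lemma anormB_le u v : anorm TH Omega a gamma (u - v)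
  <= 2 * (anorm TH Omega a gamma u + anorm TH Omega a gamma v).
Proof.
rewrite !anormE; apply: form_normB_le; first exact: energy_formP.
  exact: energy_formC.
exact: energy_form_ge0.
Qed.

End Forms.

(** * Harmonic and interior parts *)

Section SubmoduleSpan.
Context {F : fieldType} {V : vectType F}.

(** The spaces V_H^1(K) and V_h^0(K) are predicates rather than subspaces; this carries membership
    from generators to their span. *)
Lemma span_submod (P : V -> Prop) (X : seq V) v :
  P 0 -> (forall k u w, P u -> P w -> P (k *: u + w)) ->
  {in X, forall x, P x} -> v \in <<X>>%VS -> P v.
Proof.
move=> P0 PP PX /(@coord_span _ _ _ (in_tuple X)) ->.
apply: big_rec => // i u _ Pu; apply: PP => //; apply: PX.
by rewrite mem_nth.
Qed.

End SubmoduleSpan.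

Section Decomposition.
Context {R : realType} {M : fine_mesh R} (TH : coarse_mesh M).
Variables (Omega : set (R * R)) (a : R * R -> R) (a0 a1 gamma : R).
Hypothesis part : fine_partition M Omega.
Hypothesis coef : coefficient Omega a a0 a1.
Implicit Types (c d : cell M) (K : block TH) (e : edge TH) (u v w : pwbilin M).

Lemma restrictP K k u v :
  Defs.restrict K (k *: u + v) = k *: Defs.restrict K u + Defs.restrict K v.
Proof.
apply/ffunP => c; rewrite !ffunE; case: ifP => _ //.
by rewrite scaler0 addr0.
Qed.

Lemma restrict0 K : Defs.restrict K (0 : pwbilin M) = 0.
Proof. by apply/ffunP => c; rewrite !ffunE; case: ifP. Qed.

Lemma restrict_idem K u :
  Defs.restrict K (Defs.restrict K u) = Defs.restrict K u.
Proof. by apply/ffunP => c; rewrite !ffunE; case: (inblk K c). Qed.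

Lemma ev_restrict K u c x : inblk K c -> ev (Defs.restrict K u) c x = ev u c x.
Proof. by move=> Kc; rewrite /ev ffunE (Kc : inblk K c = true). Qed.

Lemma VhK_0 K : VhK K (0 : pwbilin M).
Proof. by split; [exact: restrict0 | move=> c d x *; rewrite !ev0]. Qed.

Lemma VhKP K k u v : VhK K u -> VhK K v -> VhK K (k *: u + v).
Proof.
move=> [ru cu] [rv cv]; split; first by rewrite restrictP ru rv.
by move=> c d x Kc Kd cx dx; rewrite !evP (cu c d) ?(cv c d).
Qed.

Lemma Vh0K_0 K : Vh0K K (0 : pwbilin M).
Proof. by split; [exact: VhK_0 | move=> *; rewrite ev0]. Qed.

Lemma Vh0KP K k u v : Vh0K K u -> Vh0K K v -> Vh0K K (k *: u + v).
Proof.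
move=> [ru cu] [rv cv]; split; first exact: VhKP.
by move=> c x Kc cx Kx; rewrite evP cu// cv// mulr0 addr0.
Qed.

Lemma VH1K_0 K : VH1K a K (0 : pwbilin M).
Proof.
split=> [|v _]; first exact: VhK_0.
(* With factor -1 on zero functions, linearity reads E = -E + E. *)
have := block_energyP part coef K (-1) 0 0 v.
by rewrite scaler0 addr0 mulN1r addNr.
Qed.

Lemma VH1KP K k u v : VH1K a K u -> VH1K a K v -> VH1K a K (k *: u + v).
Proof.
move=> [ru cu] [rv cv]; split; first exact: VhKP.
move=> w w0; rewrite (block_energyP part coef) cu// cv//.
by rewrite mulr0 addr0.
Qed.

Lemma Vh_VhK K u : Vh Omega u -> VhK K (Defs.restrict K u).
Proof.
move=> [cu _]; split; first exact: restrict_idem.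
by move=> c d x Kc Kd cx dx; rewrite !ev_restrict// (cu c d).
Qed.

(** The direct sum of the spaces V_h^0(K) over all coarse blocks. *)
Definition bubble v : Prop := forall K, Vh0K K (Defs.restrict K v).

Lemma bubble_frontier v K c x : bubble v -> inblk K c -> rect c x ->
  frontier (region K) x -> ev v c x = 0.
Proof.
by move=> /(_ K)[_ v0] Kc cx Kx; rewrite -(v0 c x)// ev_restrict.
Qed.

(** Pieces in one block agree by continuity there. Pieces in different blocks meet only on the
    frontiers of both blocks, where each vanishes; the frontier of [Omega] is covered by
    [frontier_region_domain]. *)
Lemma bubble_Vh v : bubble v -> Vh Omega v.
Proof.
move=> bv; split=> [c d x _ _ cx dx|c x cx Ox]; last first.
  have Kc : inblk (blk TH c) c by exact: eqxx.
  by apply: (bubble_frontier bv Kc) => //;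
    exact: (frontier_region_domain part Kc cx Ox).
have Kc : inblk (blk TH c) c by exact: eqxx.
have Kd : inblk (blk TH d) d by exact: eqxx.
have [Kcd|cd] := boolP (inblk (blk TH c) d).
  have [[_ cv] _] := bv (blk TH c).
  by rewrite -(ev_restrict _ _ Kc) -(ev_restrict _ _ Kcd); exact: cv.
rewrite (bubble_frontier bv Kc)//; last exact: frontier_region_shared cx dx.
rewrite (bubble_frontier bv Kd)//; apply: frontier_region_shared dx cx => //.
by rewrite /inblk eq_sym.
Qed.

Lemma bubble_jump v e c od s x : bubble v -> coarse_edge e ->
  on_edge Omega e c od s x -> jump (ev v) c od x = 0.
Proof.
case: e => K [K'|] bv /= KK' [/= Kc [cx _]]; case: od => [d|] //=.
  (* The strict order of ranks in [coarse_edge] rules out an interface of a block with itself, on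
     which the traces need not vanish. *)
  move=> [Kd [dx _]]; have KnK' : K != K'.
    by apply: contraTneq KK' => ->; rewrite /coarse_edge /= ltnn.
  rewrite /jump (bubble_frontier bv Kc)// ?(bubble_frontier bv Kd) ?subrr//.
    apply: frontier_region_shared dx cx => //.
    by move: Kc; rewrite /inblk => /eqP ->.
  apply: frontier_region_shared cx dx => //.
  by move: Kd; rewrite /inblk => /eqP ->; rewrite eq_sym.
move=> Ox; rewrite /jump (bubble_frontier bv Kc)//.
exact: (frontier_region_domain part Kc cx Ox).
Qed.

Lemma Vh_jump v e c od s x : Vh Omega v ->
  on_edge Omega e c od s x -> jump (ev v) c od x = 0.
Proof.
case: e => K [K'|] [cv v0] [/= Kc [cx _]]; case: od => [d|] //=.
  by move=> [Kd [dx _]]; rewrite /jump (cv c d)// subrr.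
by move=> Ox; rewrite /jump v0.
Qed.

Lemma sum_block_energy u v :
  \sum_(K : block TH) block_energy a K u v = \sum_c cell_energy a c u v.
Proof.
by rewrite [RHS](partition_big (fun c => blk TH c) xpredT).
Qed.

Lemma flux_form0 u v : Vh Omega v -> flux_form TH Omega a u v = 0.
Proof.
move=> v0; apply: big1 => e _; apply: edge_int0 => c od s x ex.
by rewrite (Vh_jump v0 ex) mulr0.
Qed.

(* Interior functions are conforming, so the interior penalty form tests them
   exactly as the fine-grid scheme does. *)
Lemma aDG_conforming u v : Vh Omega u -> Vh Omega v ->
  aDG TH Omega a gamma u v = \sum_c cell_energy a c u v.
Proof.
move=> u0 v0; rewrite aDGE !flux_form0// !subr0 /energy_form.
rewrite sum_block_energy [penalty_form _ _ _ _ _]big1 ?mulr0 ?addr0// => e _.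
apply: edge_int0 => c od s x ex.
by rewrite (Vh_jump v0 ex) mulr0.
Qed.

Lemma penalty_form_bubble u v : bubble v ->
  penalty_form TH Omega a (u + v) (u + v) = penalty_form TH Omega a u u.
Proof.
move=> bv; apply: eq_bigr => e ce; apply: eq_edge_int => c od s x ex.
have -> // : jump (ev (u + v)) c od x = jump (ev u) c od x.
by rewrite -[v]scale1r addrC jumpP (bubble_jump bv ce ex) mulr0 add0r.
Qed.

(** The penalty parts coincide since bubbles do not jump, and on each block the energies compare by
    orthogonality of harmonic and interior functions. *)
Lemma anorm_bubble u v : 0 <= gamma -> VH1 TH a u -> bubble v ->
  anorm TH Omega a gamma u <= anorm TH Omega a gamma (u + v).
Proof.
move=> g0 u1 bv; rewrite !(anormE _ _ part coef); apply: ler_wsqrtr.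
rewrite /energy_form (penalty_form_bubble _ bv) lerD2r.
apply: ler_sum => K _; apply: form_orth_le.
- by move=> *; exact: (block_energyP part coef).
- exact: block_energyC.
- by move=> *; exact: (block_energy_ge0 part coef).
- by rewrite block_energy_restrict; exact: (u1 K).2.
Qed.

(** On each block the span of a concatenation is the sum of the spans; the parts chosen block by
    block are then glued. *)
Lemma VH_decomposition (p m : block TH -> nat)
    (w z : block TH -> nat -> pwbilin M) v :
  (forall K i, (i < p K)%N -> VH1K a K (w K i)) ->
  (forall K i, (i < m K)%N -> Vh0K K (z K i)) ->
  VH p m w z v ->
  exists v1 v0, [/\ v = v1 + v0, VH1 TH a v1 & bubble v0].
Proof.
move=> w1 z0 vVH.
have dec K : exists y : pwbilin M * pwbilin M,
    [/\ Defs.restrict K v = y.1 + y.2, VH1K a K y.1 & Vh0K K y.2].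
  have := vVH K; rewrite span_cat => /memv_addP[v1 hv1 [v0 hv0 ->]].
  exists (v1, v0); split => //=.
    apply: span_submod hv1; [exact: VH1K_0 | by move=> *; exact: VH1KP |].
    by move=> _ /mapP[i + ->]; rewrite mem_iota => /andP[_ hi]; exact: w1.
  apply: span_submod hv0; [exact: Vh0K_0 | by move=> *; exact: Vh0KP |].
  by move=> _ /mapP[i + ->]; rewrite mem_iota => /andP[_ hi]; exact: z0.
have [y hy] := boolp.choice dec.
(* On each cell the glued function copies the piece of the block containing that cell; each piece is
   supported in its own block, so restriction recovers it. *)
have glue (g : block TH -> pwbilin M) K : Defs.restrict K (g K) = g K ->
    Defs.restrict K [ffun c => g (blk TH c) c] = g K.
  by move=> <-; apply/ffunP => c; rewrite !ffunE; case: ifP => // /eqP ->.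
exists [ffun c => (y (blk TH c)).1 c], [ffun c => (y (blk TH c)).2 c]; split.
- apply/ffunP => c; rewrite !ffunE -ffunE; case: (hy (blk TH c)) => E _ _.
  have := congr1 (fun u : pwbilin M => u c) E.
  by rewrite /Defs.restrict !ffunE /inblk eqxx.
- move=> K; case: (hy K) => _ h1 _.
  by rewrite (glue (fun K => (y K).1))//; case: h1 => -[].
- move=> K; case: (hy K) => _ _ h0.
  by rewrite (glue (fun K => (y K).2))//; case: h0 => -[].
Qed.

End Decomposition.

(** * Quasi-optimality of the elliptic projection *)

Theorem theorem3 (R : realType) (Omega : set (R * R)) (a : R * R -> R)
    (a0 a1 : R) (hOmega : domain Omega) (ha : coefficient Omega a a0 a1) :
  exists C : R, 0 < C /\
  forall (T : R) (f : R -> R * R -> R) (g0 g1 : R * R -> R)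
    (u : R -> R * R -> R) (Cuf : R),
  0 < T ->
  (forall t, 0 <= t <= T -> L2 Omega (f t)) ->
  wave_solution Omega a T f g0 g1 u ->
  0 <= Cuf ->
  forall (Th : fine_mesh R) (TH : coarse_mesh Th) (gamma : R)
    (mu lam : block TH -> nat -> R) (w z : block TH -> nat -> pwbilin Th)
    (nz p m : block TH -> nat) (uh ut utt : R -> pwbilin Th),
  fine_partition Th Omega ->
  penalty TH Omega a gamma ->
  (forall K, boundary_eigensystem a K (mu K) (w K)) ->
  (forall K, interior_eigensystem a K (nz K) (lam K) (z K)) ->
  (forall K, p K <= boundary_nodes K)%N ->
  (forall K, m K <= nz K)%N ->
  semidiscrete_solution Omega a T f uh ut utt ->
  forall t, 0 <= t <= T ->
  consistency TH Omega a gamma (f t) (uh t) (utt t) Cuf ->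
  forall wH : pwbilin Th,
  VH p m w z wH ->
  (forall v, VH p m w z v ->
     aDG TH Omega a gamma wH v
     = aDG TH Omega a gamma (uh t) v
       + residual TH Omega a gamma (f t) (uh t) (utt t) v) ->
  forall v, VH p m w z v ->
    anorm TH Omega a gamma (uh t - wH)
      <= C * (anorm TH Omega a gamma (uh t - v) + fine_size Th * Cuf).
Proof.
(* With x the norm of [uh t - v] and s = [Cuf * fine_size Th], the error is at most 2 (x + (4 x + 2
   s)) = 10 x + 4 s. *)
exists 10; split => // T f g0 g1 u Cuf T0 fL2 _ Cuf0 Th TH gamma mu lam w z.
move=> nz p m uh ut utt part [gamma0 pen] bes ies ple mle [_ _ uhV uh_eq] t tT.
move=> cons wH wHV galerkin v vV.
have w1 K i : (i < p K)%N -> VH1K a K (w K i).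
  have [[wV _ _ _] _ _] := bes K; move=> ip.
  by case: (wV i (leq_trans ip (ple K))).
have z0 K i : (i < m K)%N -> Vh0K K (z K i).
  by have [zV _ _ _] := ies K; move=> im; case: (zV i (leq_trans im (mle K))).
have g_ge0 := ltW gamma0.
(* The test function is w_H - v, in the form to which the linearity lemmas apply. *)
pose N := anorm TH Omega a gamma; pose phi := - 1 *: v + wH.
have phiV : VH p m w z phi.
  by move=> K; rewrite restrictP; apply: memvD => //; exact: memvZ.
have [phi1 [phi0 [phiE phi1V phi0V]]] := VH_decomposition part ha w1 z0 phiV.
have VH_VhK x : VH p m w z x -> forall K : block TH, VhK K (Defs.restrict K x).
  move=> /(VH_decomposition part ha w1 z0)[x1 [x0 [-> x1V x0V]]] K.
  rewrite -[x1]scale1r restrictP; apply: VhKP; first by case: (x1V K).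
  by case: (x0V K).
pose r := residual TH Omega a gamma (f t) (uh t) (utt t).
(* Both [uh t] and [phi0] are conforming, so a_DG reduces to the fine-grid energy and the scheme
   tested with [phi0] cancels the residual. *)
have r_phi0 : r phi0 = 0.
  have phi0h := bubble_Vh part phi0V.
  rewrite /r /residual (aDG_conforming TH _ _ (uhV t tT) phi0h).
  by rewrite -(uh_eq t tT _ phi0h) [X in X - _ - _]addrC addrK subrr.
have r_phi : r phi = r phi1.
  transitivity (r phi1 + r phi0); last by rewrite r_phi0 addr0.
  have aD : aDG TH Omega a gamma (uh t) (phi1 + phi0)
      = aDG TH Omega a gamma (uh t) phi1 + aDG TH Omega a gamma (uh t) phi0.
    rewrite [LHS]aDGC -[phi1]scale1r (aDGPl TH _ part ha) mul1r scale1r.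
    by rewrite [X in X + _]aDGC [X in _ + X]aDGC.
  rewrite phiE /r /residual (L2dotD part)//; last exact: fL2.
  rewrite L2dot_pwD aD.
  have lin (A B C D F G : R) : A + B - (C + D) - (F + G)
    = A - C - F + (B - D - G) by ring.
  exact: lin.
(* The consistency bound applies to the harmonic part, whose norm is at most that of [phi]. *)
have r_le : r phi <= Cuf * fine_size Th * N phi.
  rewrite r_phi; apply: le_trans (ler_norm _) _.
  apply: le_trans (cons _ phi1V) _; apply: ler_wpM2l.
    by rewrite mulr_ge0 ?fine_size_ge0.
  by rewrite /N phiE; exact: (anorm_bubble part ha).
have coercive : N phi ^+ 2 / 2 <= 2 * N (uh t - v) * N phi
    + Cuf * fine_size Th * N phi.
  have uvV (K : block TH) : VhK K (Defs.restrict K (uh t - v)).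
    rewrite addrC -scaleN1r restrictP; apply: VhKP; first exact: VH_VhK.
    exact: Vh_VhK (uhV t tT).
  have [_ cont] := pen _ _ uvV (VH_VhK _ phiV).
  have [coer _] := pen _ _ (VH_VhK _ phiV) (VH_VhK _ phiV).
  apply: le_trans coer _.
  (* Testing the projection equation with [phi] replaces a_DG(w_H, phi) by a_DG(u_h, phi) plus the
     residual; continuity and [r_le] bound the two terms. *)
  suff -> : aDG TH Omega a gamma phi phi
      = aDG TH Omega a gamma (uh t - v) phi + r phi by exact: lerD.
  have lin x : aDG TH Omega a gamma (- 1 *: v + x) phi
      = - 1 * aDG TH Omega a gamma v phi + aDG TH Omega a gamma x phi.
    exact: (aDGPl TH _ part ha).
  have -> : uh t - v = - 1 *: v + uh t by rewrite scaleN1r addrC.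
  by rewrite [LHS]lin [in LHS](galerkin _ phiV) addrA [in RHS]lin.
have phi_le : N phi <= 4 * N (uh t - v) + 2 * (Cuf * fine_size Th).
  apply: quadratic_le_linear coercive; try exact: anorm_ge0.
  by rewrite mulr_ge0 ?fine_size_ge0.
have -> : uh t - wH = (uh t - v) - phi.
  by rewrite /phi scaleN1r [- v + _]addrC opprB addrA subrK.
apply: le_trans (anormB_le TH part ha g_ge0 _ _) _.
have := mulr_ge0 Cuf0 (@fine_size_ge0 _ Th).
have := anorm_ge0 TH Omega a gamma (uh t - v).
rewrite -/(N _) -/(N phi) [fine_size Th * Cuf]mulrC.
move: phi_le; move: (N _) (N phi) (Cuf * _) => x y s; lra.
Qed.
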